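(* Let $m$ be a positive integer and let $B_0$ be a Ferrers board fitting inside $\Delta_{N,m}$, and let $n(\omega_m(B_0))=(n_0,n_1,\dots)$. Then $$ \sum_{B} q^{\mathrm{dinv}_m B} = q^{c(n_0,n_1,\ldots)} \prod_{i\geq 1}\begin{bmatrix} n_i+n_{i-1}+\cdots+n_{i-m}-1\\ n_i\end{bmatrix}_q, $$ where the sum is over all Ferrers boards $B$ that are $m$-weight file equivalent to $B_0$, $n_j=0$ for $j<0$, and $$ c(n_0,n_1,\ldots)=m\sum_{i\geq 0} \binom{n_i}{2} +\sum_{i\geq 1} n_i\sum_{j=1}^m (m-j)n_{i-j}. $$
   Context: A Ferrers board is the set of cells given by weakly increasing nonnegative column heights (the $b_j$ lowest cells of column $j$ in the quadrant grid). $\Delta_{N,m}=(0,m,\dots,(N-1)m)$; a board fits in $\Delta_{N,m}$ if, padded on the left with zero columns to $N$ columns $(b_0,\dots,b_{N-1})$, $b_j\le jm$ for all $j$. For such a board (always written with these $N$ columns), $\omega_m(B)=(0-b_0,m-b_1,\dots,(N-1)m-b_{N-1})$. For a vector $\nu$ of nonnegative integers, $n(\nu)=(n_0,n_1,\dots)$ with $n_i$ the number of entries equal to $i$. For a sequence $\pi=a_1\dots a_n$ of reals, $\mathrm{dinv}_m\pi=\sum_{k=0}^{m-1}|\{i<j:\ 0\le a_i-a_j+k\le m\}|$, and $\mathrm{dinv}_m B=\mathrm{dinv}_m(\omega_m(B))$. A file placement on $B$ is a set of cells (rooks) no two in the same column; with $y_i$ rooks in row $i$, $\mathrm{wt}_m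 F=\prod_i 1\downarrow_{y_i,m}$, where $x\downarrow_{y,m}=x(x-m)\cdots(x-(y-1)m)$, $x\downarrow_{0,m}=1$; $f_{k,m}(B)=\sum_F\mathrm{wt}_m F$ over file placements with $k$ rooks; $B,B'$ are $m$-weight file equivalent if $f_{k,m}(B)=f_{k,m}(B')$ for all $k$ (all boards equivalent to $B_0$ also fit in $\Delta_{N,m}$). The $q$-binomial coefficient is $\begin{bmatrix} n\\ k\end{bmatrix}_q=\frac{[n]_q!}{[k]_q![n-k]_q!}$ with $[n]_q!=\prod_{i=1}^n(1+q+\dots+q^{i-1})$. *)

(* Defs.v *)
From HB Require Import structures.
From mathcomp Require Import all_boot all_order all_algebra.

Set Implicit Arguments.
Unset Strict Implicit.
Unset Printing Implicit Defensive.

Import Order.TTheory GRing.Theory Num.Theory.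

Local Open Scope ring_scope.

(* Zero columns contain no cells, and padding with zero columns on the left    *)
(* does not change the board; so a Ferrers board is represented uniquely by    *)
(* the weakly increasing sequence of its nonzero column heights.               *)
Definition is_ferrers (B : seq nat) : bool := sorted leq B && (0%N \notin B).

(* Meaningful for size B <= N, which `fits` demands; a board weight file       *)
(* equivalent to a board that fits also fits.                                  *)
Definition pad (N : nat) (B : seq nat) : seq nat := nseq (N - size B) 0%N ++ B.

Definition fits (m N : nat) (B : seq nat) : bool :=
  (size B <= N)%N && [forall j : 'I_N, nth 0%N (pad N B) j <= j * m]%N.

Definition omega (m N : nat) (B : seq nat) : seq int :=
  [seq (j * m)%N%:Z - (nth 0%N (pad N B) j)%:Z | j <- iota 0 N].

(* Indexing by int makes n_(i - j) meaningful for j > i; on vectors of         *)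
(* nonnegative integers the value at a negative index is 0.                    *)
Definition mult (nu : seq int) (i : int) : nat := count_mem i nu.

Definition dinv (R : numDomainType) (m : nat) (a : seq R) : nat :=
  (\sum_(0 <= k < m)
     #|[set p : 'I_(size a) * 'I_(size a) |
          (p.1 < p.2)%N && (0 <= a`_p.1 - a`_p.2 + k%:R <= m%:R)%R]|)%N.

Definition dinv_board (m N : nat) (B : seq nat) : nat := dinv m (omega m N B).

Definition height (B : seq nat) : nat := (\max_(b <- B) b)%N.

(* The pair (j, r) is the cell in column j and row r, both counted from 0. *)
Notation cell B := ('I_(size B) * 'I_(height B))%type.

Definition cells (B : seq nat) : {set cell B} :=
  [set c : cell B | c.2 < nth 0%N B c.1]%N.

Definition file_placement (B : seq nat) (F : {set cell B}) : bool :=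
  (F \subset cells B) &&
  [forall c in F, forall d in F, (c.1 == d.1) ==> (c == d)].

Definition row_rooks (B : seq nat) (F : {set cell B}) (r : 'I_(height B)) : nat :=
  #|[set c in F | c.2 == r]|.

Definition falling (x : int) (y m : nat) : int :=
  \prod_(0 <= i < y) (x - (i * m)%N%:Z).

Definition wt (m : nat) (B : seq nat) (F : {set cell B}) : int :=
  \prod_(r < height B) falling 1 (row_rooks F r) m.

Definition file_number (k m : nat) (B : seq nat) : int :=
  \sum_(F : {set cell B} | file_placement F && (#|F| == k)) wt m F.

Definition weight_file_equiv (m : nat) (B B' : seq nat) : Prop :=
  forall k : nat, file_number k m B = file_number k m B'.

Definition qfact (K : fieldType) (q : K) (n : nat) : K :=
  \prod_(1 <= i < n.+1) \sum_(0 <= j < i) q ^+ j.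

Definition qbinom (K : fieldType) (q : K) (n k : nat) : K :=
  if (k <= n)%N then qfact q n / (qfact q k * qfact q (n - k)) else 0.

(* For a board fitting in Delta_(N,m) the entries of omega lie in              *)
(* [0, (N - 1) m], so n_i = 0 for i > N m and the sums and the product over    *)
(* all i may be cut off at M = N m: the omitted summands are 0 and the         *)
(* omitted factors are 1.                                                      *)
Definition cexp (m M : nat) (n : int -> nat) : nat :=
  (m * (\sum_(0 <= i < M.+1) 'C(n i%:Z, 2))
   + \sum_(1 <= i < M.+1)
       n i%:Z * \sum_(1 <= j < m.+1) (m - j) * n (i%:Z - j%:Z)%R)%N.

(* The predecessor is truncated (0 - 1 = 0), which matters only if             *)
(* n_i = ... = n_(i - m) = 0; the factor is then 1, by the convention that     *)
(* binomial coefficients with lower index 0 are 1.                             *)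
Definition qprod (K : fieldType) (q : K) (m M : nat) (n : int -> nat) : K :=
  \prod_(1 <= i < M.+1)
     qbinom q (\sum_(0 <= j < m.+1) n (i%:Z - j%:Z)%R).-1%N (n i%:Z).

(* The indeterminate q of the field Q(q) of rational functions. *)
Definition qvar : {fraction {poly rat}} := tofrac ('X : {poly rat}).

(* Main.v *)
(* With heights padded to [N] columns, [sum_k f_k(B) x(x-m)...(x-(N-k-1)m)] is   *)
(* the product of the factors [x - w_j], where [w = omega_m(B)]; hence two boards *)
(* are equivalent exactly when their [omega] vectors are rearrangements of each   *)
(* other. The vectors that arise are the words of nonnegative integers with       *)
(* [w_0 = 0] and [w_(j+1) <= w_j + m]. On such a class, [dinv] is the constant     *)
(* [c] plus the number of inversions [w_i > w_j] with [w_i - w_j <= m]. Such words *)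
(* are built by inserting all copies of the letter [1], then of [2], and so on:    *)
(* each copy of [i] goes after a letter of [i - m, i], so that the copies of [i]   *)
(* form a partition in a box and contribute one q-binomial coefficient.           *)

Require Import Defs.
From mathcomp Require Import all_boot all_order all_algebra.
From mathcomp Require Import zify ring.

Set Implicit Arguments.
Unset Strict Implicit.
Unset Printing Implicit Defensive.

Import Order.TTheory GRing.Theory Num.Theory.

Local Open Scope ring_scope.

(** * File placements *)

(** Given [k] rooks to the left of a column of height [b], a rook in that column multiplies the
    weight by factors that sum to [b - k m] over its cells ([sum_new_rook]). The resulting
    recurrence factors the generating polynomial of the file numbers over the entries of [omega]
    ([omega_factorization]). So equivalence means rearrangement of [omega]
    ([weight_file_equiv_omega]), and [omega_board] and [board_of_omega] turn the class of [B0] into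
    the words of fixed content that start with [0] and rise by at most [m] per step.

    Two letters [x], [y] in this order contribute to [dinv] the symmetric amount
    [max(0, m - |x - y|)], plus [1] if [y < x <= y + m] ([dinv_pair]). The symmetric part depends on
    the content only and adds up to [c] ([cexp_closeness]). The inversions, counted by [minv], are
    handled by deleting all copies of the largest letter: by [insertion_gf], putting them back
    contributes a q-binomial that does not depend on the smaller word, whence the product
    ([has_gf_bind], [words_gf]). *)

Section FileNumbers.
Variables (m : nat) (B : seq nat).
Hypothesis sB : sorted leq B.

Definition left_of (t : nat) (F : {set cell B}) : bool :=
  [forall c in F, (c.1 < t)%N].

Definition partial_file_number (t k : nat) : int :=
  \sum_(F | [&& file_placement F, left_of t F & #|F| == k]) wt m F.

Lemma partial_file_number_full k :
  partial_file_number (size B) k = file_number k m B.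
Proof.
apply: eq_bigl => F; have -> // : left_of (size B) F.
by apply/forall_inP => c _; apply: ltn_ord.
Qed.

Lemma left_of0 F : left_of 0 F = (F == set0).
Proof.
apply/forall_inP/eqP => [h | -> c]; last by rewrite inE.
by apply/setP => c; rewrite inE; apply/negP => /h.
Qed.

Lemma partial_file_number0 k : partial_file_number 0 k = (k == 0%N)%:R.
Proof.
have fp0 : file_placement (set0 : {set cell B}).
  by rewrite /file_placement sub0set; apply/forall_inP => c; rewrite inE.
rewrite /partial_file_number; case: eqVneq => [-> | k0].
  rewrite (big_pred1 set0) => [|F]; last first.
    rewrite left_of0 /=; case: eqVneq => [->|_]; last by rewrite andbF.
    by rewrite fp0 cards0.
  rewrite /wt big1 // => r _; rewrite /row_rooks.
  rewrite (_ : [set c in set0 | c.2 == r] = set0) ?cards0 /falling ?big_geq //.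
  by apply/setP => c; rewrite !inE.
rewrite big_pred0 // => F; rewrite left_of0; case: eqVneq => [->|]; last by rewrite andbF.
by rewrite cards0 eq_sym (negPf k0) !andbF.
Qed.

Lemma falling1S (y : nat) : falling 1 y.+1 m = falling 1 y m * (1 - (y * m)%N%:Z).
Proof. by rewrite /falling big_nat_recr. Qed.

Lemma wtU1 (c : cell B) (F : {set cell B}) :
  c \notin F -> wt m (c |: F) = wt m F * (1 - (row_rooks F c.2 * m)%N%:Z).
Proof.
move=> cF; rewrite /wt (bigD1 c.2) //= [in RHS](bigD1 c.2) //=.
have -> : row_rooks (c |: F) c.2 = (row_rooks F c.2).+1.
  rewrite /row_rooks (_ : [set d in c |: F | _] = c |: [set d in F | d.2 == c.2]).
    by rewrite cardsU1 inE (negPf cF).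
  by apply/setP => d; rewrite !inE; case: eqVneq => // ->; rewrite eqxx.
rewrite falling1S mulrAC; congr (_ * _ * _); apply: eq_bigr => r rc.
congr (falling _ _ _); rewrite /row_rooks; congr #|pred_of_set _|.
apply/setP => d; rewrite !inE; case: eqVneq => // ->.
by rewrite eq_sym (negPf rc) !andbF.
Qed.

Lemma sum_row_rooks (F : {set cell B}) : (\sum_r row_rooks F r)%N = #|F|.
Proof.
rewrite -sum1_card (partition_big (fun c : cell B => c.2) xpredT) //=.
apply: eq_bigr => r _; rewrite /row_rooks -sum1_card; apply: eq_bigl => c.
by rewrite inE.
Qed.

(** When [c \notin F], deleting [c] undoes adding it; this reindexes the placements whose last
    column has the rook [c] by placements strictly to its left. *)
Lemma left_placementU1 (c : cell B) (F : {set cell B}) k :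
  [&& file_placement (c |: F), left_of c.1.+1 (c |: F) & #|c |: F| == k.+1]
    && (c \notin F)
  = [&& file_placement F, left_of c.1 F & #|F| == k] && (c \in cells B).
Proof.
case: (boolP (c \in F)) => cF /=.
  rewrite andbF; apply/esym/negbTE/negP => /andP[/and3P[_ /forall_inP/(_ _ cF)]].
  by rewrite ltnn.
rewrite andbT cardsU1 cF eqSS; case: (#|F| == k); rewrite ?andbF // !andbT.
apply/andP/andP => [[/andP[/subsetP sF /forall_inP fF] /forall_inP lF]|].
  have cc : c \in c |: F by rewrite !inE eqxx.
  have inF d : d \in F -> d \in c |: F by rewrite !inE orbC => ->.
  split; last exact: sF.
  apply/andP; split; last first.
    apply/forall_inP => d dF; have := lF d (inF _ dF); rewrite ltnS leq_eqVlt.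
    case/orP => // /eqP /val_inj e; have /forall_inP/(_ c cc) := fF _ (inF _ dF).
    by rewrite e eqxx /= => /eqP ed; move: cF; rewrite -ed dF.
  apply/andP; split; first by apply/subsetP => d /inF/sF.
  apply/forall_inP => d dF; apply/forall_inP => e eF.
  by have /forall_inP/(_ e (inF _ eF)) := fF _ (inF _ dF).
move=> [/andP[/andP[/subsetP sF /forall_inP fF] /forall_inP lF] cB].
have nc d : d \in F -> d.1 != c.1 by move/lF; rewrite ltn_neqAle => /andP[].
split; first (apply/andP; split).
- by apply/subsetP => d; rewrite !inE => /orP[/eqP->|/sF]; [move: cB|]; rewrite inE.
- apply/forall_inP => d; rewrite !inE => /orP[/eqP->|dF];
    apply/forall_inP => e; rewrite !inE => /orP[/eqP->|eF] //.
  + by rewrite !eqxx.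
  + by rewrite eq_sym (negPf (nc e eF)).
  + by rewrite (negPf (nc d dF)).
  + by have /forall_inP/(_ e eF) := fF _ dF.
- apply/forall_inP => d; rewrite !inE => /orP[/eqP->//|/lF]; exact: ltnW.
Qed.

Lemma nth_sorted_leq i j : (i <= j < size B)%N -> (nth 0%N B i <= nth 0%N B j)%N.
Proof.
case/andP=> ij jB; apply: (sorted_leq_nth leq_trans leqnn) => //.
by rewrite inE (leq_ltn_trans ij jB).
Qed.

(* The heights increase, so every rook to the left of column [t] lies in a row *)
(* that meets column [t].                                                      *)
Lemma sum_new_rook (t : 'I_(size B)) (F : {set cell B}) :
  file_placement F -> left_of t F ->
  \sum_(r | (t, r) \in cells B) (1 - (row_rooks F r * m)%N%:Z)
  = (nth 0%N B t)%:Z - (#|F| * m)%N%:Z.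
Proof.
move=> /andP[/subsetP sF _] /forall_inP lF.
have bt : (nth 0%N B t <= height B)%N.
  by apply: (@leq_bigmax_seq _ B xpredT id) => //; apply: mem_nth.
rewrite sumrB; congr (_ - _).
  rewrite sumr_const -[RHS]natz; congr (_ *+ _).
  rewrite -sum1_card (eq_bigl (fun r : 'I_(height B) => (r < nth 0%N B t)%N))
    => [|r]; last first.
    by transitivity ((t, r) \in cells B); last rewrite inE.
  by rewrite -(big_ord_widen _ (fun=> 1%N) bt) sum1_card card_ord.
rewrite -(big_morph Posz PoszD (erefl _)); congr Posz.
rewrite -big_distrl /=; congr (_ * _)%N.
rewrite -sum_row_rooks [RHS](bigID (fun r => (t, r) \in cells B)) /=.
rewrite [X in (_ + X)%N]big1 ?addn0 // => r; rewrite inE /= -leqNgt => tr.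
apply/eqP; rewrite cards_eq0; apply/eqP/setP => c; rewrite !inE.
apply/negP => /andP[cF /eqP cr]; have := sF c cF; rewrite inE cr ltnNge.
rewrite (leq_trans _ tr) // nth_sorted_leq // ltn_ord andbT.
by apply: ltnW; apply: lF.
Qed.

Lemma partial_file_numberS0 (t : 'I_(size B)) :
  partial_file_number t.+1 0 = partial_file_number t 0.
Proof.
apply: eq_bigl => F; rewrite cards_eq0.
case: (eqVneq F set0) => [->|]; rewrite ?andbF //.
by congr [&& _, _ & _]; apply/forall_inP/forall_inP => _ c; rewrite inE.
Qed.

(** Column [t] is empty or has exactly one rook; removing that rook leaves [k] rooks to the left,
    and [sum_new_rook] sums over its possible rows. *)
Lemma partial_file_numberS (t : 'I_(size B)) k :
  partial_file_number t.+1 k.+1 = partial_file_number t k.+1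
    + partial_file_number t k * ((nth 0%N B t)%:Z - (k * m)%N%:Z).
Proof.
rewrite {1}/partial_file_number (bigID (left_of t)) /=; congr (_ + _).
  apply: eq_bigl => F; case: (boolP (left_of t F)) => lF; rewrite ?andbF // andbT.
  have -> // : left_of t.+1 F.
  by apply/forall_inP => c cF; apply: ltnW; rewrite ltnS; move/forall_inP: lF; apply.
rewrite big_distrl /=.
pose PS F := [&& file_placement F, left_of t.+1 F & #|F| == k.+1].
pose P F := [&& file_placement F, left_of t F & #|F| == k].
(* A placement that is not left of [t] has exactly one rook in column [t], so summing over the row
   [r] of this rook counts it once. *)
transitivity (\sum_r \sum_(F | PS F && ((t, r) \in F)) wt m F).
  rewrite (exchange_big_dep PS) /=; last first.
    by move=> r F _ /andP[].
  rewrite [RHS](bigID (left_of t)) /= [X in _ = X + _]big1 ?add0r; last first.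
    move=> F /andP[_ /forall_inP lF]; rewrite big_pred0 // => r.
    by apply/negP => /andP[_ /lF]; rewrite ltnn.
  apply: eq_bigr => F /andP[/and3P[fF lF kF] nl].
  have [r trF] : exists r, (t, r) \in F.
    move: nl; rewrite negb_forall_in => /exists_inP[[t' r] cF]; rewrite -leqNgt /= => tt'.
    exists r; suff <- : t' = t by [].
    apply/val_inj/eqP; rewrite eqn_leq tt' andbT.
    by move/forall_inP/(_ _ cF): lF.
  rewrite (big_pred1 r) // => r'; rewrite /PS fF lF kF /=; apply/idP/eqP => [tr'|->] //.
  move: fF => /andP[_ /forall_inP/(_ _ tr')/forall_inP/(_ _ trF)].
  by rewrite eqxx => /eqP[].
transitivity (\sum_r \sum_(F | P F && ((t, r) \in cells B))
    wt m F * (1 - (row_rooks F r * m)%N%:Z)).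
  apply: eq_bigr => r _.
  rewrite (reindex_onto (fun F => (t, r) |: F) (fun F => F :\ (t, r))) /=; last first.
    by move=> F /andP[_ tF]; rewrite setD1K.
  have trF F :
    ((t, r) \in (t, r) |: F) && (((t, r) |: F) :\ (t, r) == F) = ((t, r) \notin F).
    rewrite !inE eqxx /=; apply/eqP/idP => [<-|]; first by rewrite !inE eqxx.
    exact: setU1K.
  have eP F : [&& file_placement ((t, r) |: F), left_of t.+1 ((t, r) |: F)
                & #|(t, r) |: F| == k.+1] &&
      ((t, r) \in (t, r) |: F) && (((t, r) |: F) :\ (t, r) == F)
    = [&& file_placement F, left_of t F & #|F| == k] && ((t, r) \in cells B).
    by rewrite -(@left_placementU1 (t, r)) -trF /= !andbA.
  by apply: eq_big => // F; rewrite -andbA trF => /andP[_ tF]; rewrite wtU1.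
rewrite (exchange_big_dep P) /=; last first.
  by move=> r F _ /andP[].
apply: eq_bigr => F /and3P[fF lF kF]; rewrite -big_distrr /=; congr (_ * _).
by rewrite -(eqP kF) -sum_new_rook //; apply: eq_bigl => r; rewrite /P fF lF kF.
Qed.

Lemma partial_file_number_gt t k :
  (t <= size B)%N -> (t < k)%N -> partial_file_number t k = 0.
Proof.
elim: t k => [|t IH] [|k] // tB tk; first by rewrite partial_file_number0.
rewrite -[t]/(val (Ordinal tB)) partial_file_numberS /= IH ?IH ?mul0r ?addr0 //;
  exact: ltnW.
Qed.

Definition falling_poly (n : nat) : {poly int} :=
  \prod_(0 <= i < n) ('X - ((i * m)%N%:Z)%:P).

(** [z] is the number of padding zero columns. In the induction the new factor splits as [x - (z +
    t) m + b_t = (x - (z + t - k) m) + (b_t - k m)]: the first part lengthens the falling product,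
    the second is the coefficient in [partial_file_numberS]. *)
Lemma partial_factorization z t :
  (t <= size B)%N ->
  falling_poly z *
    \prod_(0 <= j < t) ('X - (((z + j) * m)%N%:Z - (nth 0%N B j)%:Z)%:P)
  = \sum_(k < t.+1) partial_file_number t k *: falling_poly (z + t - k).
Proof.
elim: t => [|t IH] tB.
  by rewrite big_geq // mulr1 big_ord1 partial_file_number0 addn0 subn0 scale1r.
rewrite big_nat_recr //= mulrA IH; last exact: ltnW.
have pS := partial_file_numberS (Ordinal tB).
have pS0 := partial_file_numberS0 (Ordinal tB).
rewrite /= in pS pS0.
rewrite [in RHS]big_ord_recl /= pS0 subn0.
under [in RHS]eq_bigr => k _ do rewrite /bump /= add1n pS scalerDl.
rewrite big_split /= addrA.
transitivity (\sum_(k < t.+2) partial_file_number t k *: falling_poly (z + t.+1 - k)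
   + \sum_(k < t.+1) (partial_file_number t k * ((nth 0%N B t)%:Z - (k * m)%N%:Z))
       *: falling_poly (z + t - k)); last first.
  congr (_ + _); last by apply: eq_bigr => k _; congr (_ *: falling_poly _); lia.
  by rewrite [in LHS]big_ord_recl /= subn0; congr (_ + _).
rewrite [in RHS]big_ord_recr /= (@partial_file_number_gt t t.+1) ?scale0r ?addr0 //;
  last exact: ltnW.
rewrite big_distrl -big_split /=; apply: eq_bigr => k _.
have kt : (k <= t)%N by rewrite -ltnS.
have -> : (z + t.+1 - k)%N = (z + t - k).+1 by lia.
rewrite {2}/falling_poly big_nat_recr //= -/(falling_poly _).
rewrite -scalerA -scalerAl -scalerDr; congr (_ *: _).
rewrite -mul_polyC [in RHS]mulrC -mulrDl [in RHS]mulrC; congr (_ * _).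
have {1}-> : (z + t)%N = ((z + t - k) + k)%N by lia.
rewrite mulnDl PoszD !polyCB polyCD; ring.
Qed.
End FileNumbers.

(** * Equivalence of boards as rearrangement of [omega] *)

Section Factorization.
Variables (m : nat).

Lemma size_pad N B : (size B <= N)%N -> size (pad N B) = N.
Proof. by move=> BN; rewrite size_cat size_nseq subnK. Qed.

Lemma size_omega N B : size (omega m N B) = N.
Proof. by rewrite size_map size_iota. Qed.

Lemma nth_omega N B j : (j < N)%N ->
  nth 0 (omega m N B) j = (j * m)%N%:Z - (nth 0%N (pad N B) j)%:Z.
Proof. by move=> jN; rewrite (nth_map 0%N) ?size_iota // nth_iota. Qed.

Lemma omega_factorization N B : sorted leq B -> (size B <= N)%N ->
  \prod_(x <- omega m N B) ('X - x%:P)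
  = \sum_(k < N.+1) file_number k m B *: falling_poly m (N - k).
Proof.
move=> sB BN; set z := (N - size B)%N; have zE : N = (z + size B)%N by rewrite subnK.
have := partial_factorization m sB z (leqnn _).
under [in RHS]eq_bigr => k _ do rewrite partial_file_number_full -zE.
move=> e.
rewrite big_map {1}zE iotaD big_cat /=.
(* A placement has at most one rook per column, so the terms with [k > size B] vanish. *)
transitivity (\sum_(k < (size B).+1) file_number k m B *: falling_poly m (N - k));
  last first.
  rewrite (big_ord_widen N.+1 (fun k => file_number k m B *: falling_poly m (N - k))) //.
  rewrite [RHS](bigID (fun k : 'I_N.+1 => (k < (size B).+1)%N)) /=.
  rewrite [X in _ = _ + X]big1 ?addr0 // => k.
  rewrite -leqNgt => Bk; rewrite -partial_file_number_full.
  by rewrite partial_file_number_gt ?scale0r.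
rewrite -{}e; congr (_ * _).
  rewrite /falling_poly /index_iota subn0; apply: eq_big_seq => j.
  by rewrite mem_iota => /andP[_ jz]; rewrite nth_cat size_nseq -/z jz nth_nseq jz subr0.
rewrite add0n -{1}[z]addn0 iotaDl big_map /index_iota subn0; apply: eq_big_seq => j _.
by rewrite nth_cat size_nseq -/z ltnNge leq_addr addKn.
Qed.

Lemma falling_poly_monic n : falling_poly m n \is monic.
Proof. exact: monic_prod_XsubC. Qed.

Lemma size_falling_poly n : size (falling_poly m n) = n.+1.
Proof. by rewrite size_prod_XsubC size_iota subn0. Qed.

(** The polynomials are monic of distinct degrees, so the leading coefficient forces [c 0 = 0], and
    induction applies to the rest. *)
Lemma falling_poly_free N (c : nat -> int) :
  \sum_(k < N.+1) c k *: falling_poly m (N - k) = 0 ->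
  forall k, (k <= N)%N -> c k = 0.
Proof.
elim: N c => [|N IH] c.
  rewrite big_ord1 subn0 => /(congr1 (fun p : {poly int} => p`_0)).
  rewrite coefZ coef0 /falling_poly big_geq // coef1 mulr1 => c0 k.
  by rewrite leqn0 => /eqP->.
rewrite big_ord_recl /= subn0 => e.
have c0 : c 0%N = 0.
  move: (congr1 (fun p : {poly int} => p`_N.+1) e).
  rewrite coefD coefZ coef_sum coef0 big1 => [|i _]; last first.
    rewrite coefZ nth_default ?mulr0 // size_falling_poly /bump /=; lia.
  have := falling_poly_monic N.+1; rewrite monicE lead_coefE size_falling_poly /=.
  by move/eqP->; rewrite addr0 mulr1.
move: e; rewrite c0 scale0r add0r => e [|k] // kN.
by apply: (IH (fun k => c k.+1)).
Qed.

(** Unique factorization is applied over [rat]; the embedding of [int] is injective. *)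
Lemma perm_eq_prod_XsubC (s t : seq int) :
  \prod_(x <- s) ('X - x%:P) = \prod_(x <- t) ('X - x%:P) :> {poly int} ->
  perm_eq s t.
Proof.
have toQ r : map_poly (intr : int -> rat) (\prod_(x <- r) ('X - x%:P))
    = \prod_(x <- [seq (y%:~R : rat) | y <- r]) ('X - x%:P).
  by rewrite rmorph_prod big_map; apply: eq_bigr => x _; rewrite /= map_polyXsubC.
move/(congr1 (map_poly (intr : int -> rat))); rewrite !toQ => /prod_XsubC_eq.
by apply: perm_map_inj; apply: intr_inj.
Qed.

Lemma weight_file_equiv_omega N B B' :
  sorted leq B -> sorted leq B' -> (size B <= N)%N -> (size B' <= N)%N ->
  weight_file_equiv m B B' <-> perm_eq (omega m N B) (omega m N B').
Proof.
move=> sB sB' BN BN'; split=> [e | e k].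
  apply: perm_eq_prod_XsubC; rewrite !omega_factorization //.
  by apply: eq_bigr => k _; rewrite e.
have [kN|Nk] := leqP k N; last first.
  rewrite -!partial_file_number_full !partial_file_number_gt //.
    by apply: leq_ltn_trans Nk.
  by apply: leq_ltn_trans Nk.
apply/eqP; rewrite -subr_eq0; apply/eqP.
apply: (falling_poly_free (c := fun k => file_number k m B - file_number k m B') _ kN).
under eq_bigr => i _ do rewrite scalerBl.
by rewrite sumrB -!omega_factorization // (perm_big _ e) subrr.
Qed.

End Factorization.

(** * Words *)

(** The enumeration [L] makes the finiteness of [P] part of the statement, since the boards and
    words concerned live in infinite types. *)
Definition has_gf (T : eqType) (K : nmodType) (P : pred T) (f : T -> K) (x : K) : Prop :=
  exists L : seq T,
    [/\ uniq L, forall t, (t \in L) = P t & \sum_(t <- L) f t = x].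

Section GeneratingFunctions.
Variables (T : eqType).

Lemma has_gf_ext (K : nmodType) (P Q : pred T) (f : T -> K) x y :
  has_gf P f x -> P =1 Q -> x = y -> has_gf Q f y.
Proof. by move=> [L [uL LP sL]] PQ <-; exists L; split=> // t; rewrite LP PQ. Qed.

Lemma has_gf0 (K : nmodType) (f : T -> K) : has_gf pred0 f 0.
Proof. by exists [::]; rewrite big_nil. Qed.

Lemma has_gf1 (K : nmodType) (f : T -> K) t : has_gf (pred1 t) f (f t).
Proof. by exists [:: t]; rewrite big_seq1; split=> // s; rewrite inE. Qed.

Lemma has_gfU (K : nmodType) (P Q : pred T) (f : T -> K) x y :
  (forall t, ~~ (P t && Q t)) ->
  has_gf P f x -> has_gf Q f y -> has_gf (predU P Q) f (x + y).
Proof.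
move=> PQ [L [uL LP <-]] [L' [uL' LQ <-]]; exists (L ++ L'); rewrite big_cat.
split=> // [|t]; last by rewrite mem_cat LP LQ.
rewrite cat_uniq uL uL' andbT; apply/hasPn => t tL'; rewrite LP.
by have := PQ t; rewrite -LQ tL' andbT.
Qed.

Lemma has_gf_inj (T' : eqType) (K : nmodType) (h : T -> T') (P : pred T)
    (f : T' -> K) x :
  injective h -> has_gf P (f \o h) x ->
  exists L : seq T', [/\ uniq L, forall t, t \in L <-> exists2 s, P s & t = h s
                       & \sum_(t <- L) f t = x].
Proof.
move=> injh [L [uL LP <-]]; exists (map h L); rewrite big_map map_inj_uniq //.
split=> // t; split=> [/mapP[s] | [s Ps ->]]; first by rewrite LP; exists s.
by rewrite map_f ?LP.
Qed.

End GeneratingFunctions.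

(** [Q u] lies in the fibre of [h] over [u]. Every [Q u] weighs the same multiple [y] of its base
    point, so the total is a product. *)
Lemma has_gf_bind (T T' : eqType) (K : pzSemiRingType) (h : T' -> T) (P : pred T)
    (Q : T -> pred T') (f : T -> K) (g : T' -> K) x y :
  (forall u v, Q u v -> h v = u) ->
  (forall u, P u -> has_gf (Q u) g (f u * y)) ->
  has_gf P f x -> has_gf (fun v => P (h v) && Q (h v) v) g (x * y).
Proof.
move=> Qh gfQ [L [uL LP <-]].
have {}gfQ u : u \in L -> has_gf (Q u) g (f u * y) by rewrite LP; apply: gfQ.
suff: has_gf (fun v => (h v \in L) && Q (h v) v) g ((\sum_(t <- L) f t) * y).
  by move=> gfL; apply: has_gf_ext gfL _ _ => // v; rewrite LP.
elim: L uL gfQ {LP} => [|u L IH] /=.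
  by move=> _ _; rewrite big_nil mul0r; apply: has_gf0.
case/andP=> uL uniqL gfQ; rewrite big_cons mulrDl.
have gfu := gfQ u (mem_head _ _).
have {IH} gfL := IH uniqL (fun t tL => gfQ t (mem_behead (s := u :: L) tL)).
have dis v : ~~ (Q u v && ((h v \in L) && Q (h v) v)).
  by apply/negP => /and3P[/Qh ->]; rewrite (negPf uL).
apply: has_gf_ext (has_gfU dis gfu gfL) _ _ => // v.
rewrite /= inE; apply/orP/andP => [[Quv|/andP[-> ->]]|[]].
- by rewrite (Qh _ _ Quv) eqxx.
- by rewrite orbT.
- by case/orP=> [/eqP->|->] ->; [left | right].
Qed.

Lemma has_gf_scale (T : eqType) (K : pzSemiRingType) (P : pred T) (f g : T -> K) a x :
  (forall t, P t -> g t = a * f t) -> has_gf P f x -> has_gf P g (a * x).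
Proof.
move=> gf [L [uL LP <-]]; exists L; split=> //.
by rewrite big_distrr; apply: eq_big_seq => t; rewrite LP; apply: gf.
Qed.

Lemma has_gf_cons (T : eqType) (K : nmodType) (a : T) (P : pred (seq T))
    (f : seq T -> K) x :
  has_gf P (fun v => f (a :: v)) x ->
  has_gf (fun w => if w is b :: v then (b == a) && P v else false) f x.
Proof.
have inj_cons : injective (cons a) by move=> ? ? [].
move=> /(has_gf_inj inj_cons)[L [uL LP sL]]; exists L; split=> // t.
apply/idP/idP => [/LP[s Ps ->]|]; first by rewrite eqxx.
by case: t => // b t /andP[/eqP-> Pt]; apply/LP; exists t.
Qed.

(** * The q-Pascal rule *)

Section QBinomial.
Variables (K : fieldType) (q : K).
Hypothesis q_neq0 : forall n, \sum_(0 <= j < n.+1) q ^+ j != 0.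

Lemma qfactS n : qfact q n.+1 = qfact q n * \sum_(0 <= j < n.+1) q ^+ j.
Proof. by rewrite /qfact big_nat_recr. Qed.

Lemma qfact_neq0 n : qfact q n != 0.
Proof.
elim: n => [|n IH]; first by rewrite /qfact big_geq ?oner_eq0.
by rewrite qfactS mulf_neq0.
Qed.

Lemma qbinomn0 n : qbinom q n 0 = 1.
Proof.
by rewrite /qbinom /= subn0 {2}/qfact big_geq // mul1r divff ?qfact_neq0.
Qed.

Lemma qbinomnn n : qbinom q n n = 1.
Proof.
rewrite /qbinom leqnn subnn [qfact q 0]/qfact big_geq // mulr1.
by rewrite divff ?qfact_neq0.
Qed.

Lemma qbinom_small n k : (n < k)%N -> qbinom q n k = 0.
Proof. by rewrite /qbinom ltnNge => /negbTE->. Qed.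

(** With [[j]] the q-integer, this is the splitting [[n + 1] = [n - k] + q^(n - k) [k + 1]] after
    clearing denominators. *)
Lemma qbinomS n k : (k <= n)%N ->
  qbinom q n.+1 k.+1 = q ^+ (n - k) * qbinom q n k + qbinom q n k.+1.
Proof.
rewrite leq_eqVlt => /orP[/eqP-> | kn].
  by rewrite !qbinomnn subnn mul1r qbinom_small ?addr0.
have [d ->] : exists d, n = (k + d.+1)%N by exists (n - k.+1)%N; lia.
rewrite /qbinom.
have -> : (k.+1 <= (k + d.+1).+1)%N by lia.
have -> : (k <= k + d.+1)%N by lia.
have -> : (k < k + d.+1)%N by lia.
have -> : ((k + d.+1).+1 - k.+1 = d.+1)%N by lia.
have -> : (k + d.+1 - k = d.+1)%N by lia.
have -> : (k + d.+1 - k.+1 = d)%N by lia.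
have e : \sum_(0 <= j < (k + d.+1).+1) q ^+ j
    = \sum_(0 <= j < d.+1) q ^+ j + q ^+ d.+1 * \sum_(0 <= j < k.+1) q ^+ j.
  have -> : (k + d.+1).+1 = (d.+1 + k.+1)%N by lia.
  rewrite (@big_cat_nat _ _ _ d.+1) ?leq_addr //=; congr (_ + _).
  rewrite -{1}[d.+1]add0n big_addn addKn big_distrr; apply: eq_bigr => j _.
  by rewrite addnC exprD.
rewrite !qfactS e.
have := q_neq0 d; have := q_neq0 k; have := qfact_neq0 k; have := qfact_neq0 d.
move: (\sum_(0 <= j < d.+1) _) (\sum_(0 <= j < k.+1) _) => D1 K1.
by move=> *; field; apply/and4P.
Qed.

End QBinomial.

(** * Inserting the copies of a largest letter *)

Section Words.
Variables (m : nat).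

(** On consecutive entries of [omega], this says that the column heights do not decrease. *)
Definition small_rise : rel nat := fun a b => (b <= a + m)%N.

(** These smaller letters play two roles: [i] may directly follow them, and [i] is inverted with
    them when they come later. *)
Definition near (i : nat) : pred nat := fun b => (b < i <= b + m)%N.

Fixpoint minv (w : seq nat) : nat :=
  if w is a :: w' then (count (near a) w' + minv w')%N else 0%N.

Lemma path_all_lt i p u :
  all (ltn^~ i) u -> path small_rise p u -> path small_rise i u.
Proof.
case: u => //= a u /andP[/ltnW ai _] /andP[_ ->]; rewrite andbT.
exact: leq_trans ai (leq_addr _ _).
Qed.

Lemma filter_all_lt i (u : seq nat) : all (ltn^~ i) u -> filter (predC1 i) u = u.
Proof.
move=> ui; apply/all_filterP/allP => x /(allP ui) /= xi.
by rewrite neq_ltn xi.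
Qed.

Lemma count_near_filter i w : count (near i) (filter (predC1 i) w) = count (near i) w.
Proof.
rewrite count_filter; apply: eq_count => b; rewrite /near /=.
by case: (eqVneq b i) => [->|]; rewrite ?ltnn ?andbT.
Qed.

Definition insertion (i p : nat) (u : seq nat) (c : nat) : pred (seq nat) :=
  fun v => [&& path small_rise p v, filter (predC1 i) v == u & count_mem i v == c].

Lemma insertion_cons_max i p u c v :
  insertion i p u c.+1 (i :: v) = (i <= p + m)%N && insertion i i u c v.
Proof. by rewrite /insertion /= eqxx /= add1n eqSS -andbA. Qed.

Lemma insertion_cons i p u c b v : b != i ->
  insertion i p u c (b :: v)
  = (b <= p + m)%N && (if u is a :: u' then (b == a) && insertion i b u' c v else false).
Proof.
move=> bi; rewrite /insertion /= bi (negPf bi) add0n -andbA; congr (_ && _).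
by case: u => [|a u]; rewrite ?andbF // eqseq_cons; case: (b == a); rewrite ?andbF.
Qed.

Section InsertMax.
Variables (K : fieldType) (q : K).
Hypothesis q_neq0 : forall n, \sum_(0 <= j < n.+1) q ^+ j != 0.

Lemma insertion_minv i p u c v a :
  a != i -> insertion i p u c v -> (a <= i)%N -> count (near a) v = count (near a) u.
Proof.
move=> ai /and3P[_ /eqP <- _] lai; rewrite count_filter; apply: eq_count => b.
by rewrite /near /=; case: (eqVneq b i) => [->|]; rewrite ?andbT // ltnNge lai.
Qed.

(* [p] is the letter that precedes the word. A copy of [i] may follow another   *)
(* copy or a letter in [i - m, i[; it is inverted with the letters of [i - m, i[ *)
(* after it, so the positions of the copies form a partition in a box.         *)
Lemma insertion_gf i c u p :
  path small_rise p u -> all (ltn^~ i) u ->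
  has_gf (insertion i p u c) (fun v => q ^+ minv v)
    (q ^+ minv u * qbinom q (c + (count (near i) u + (i <= p + m))).-1 c).
Proof.
elim: c u p => [|c IHc] u p pu ui.
  rewrite qbinomn0 // mulr1.
  apply: has_gf_ext (has_gf1 (fun v => q ^+ minv v) u) _ _ => // v.
  apply/eqP/and3P => [->|[_ /eqP <- /eqP c0]].
    rewrite filter_all_lt // eqxx pu; split=> //.
    by rewrite -leqn0 leqNgt -has_count; apply/hasPn => x /(allP ui) /= /ltn_eqF->.
  by apply/esym/all_filterP; rewrite all_predC has_count c0.
(* Words that begin with a copy of [i]. It is inverted with every near letter of [u']; the other [c]
   copies see [i] as predecessor, so their front slot is always open. *)
have gfi p' u' : path small_rise p' u' -> all (ltn^~ i) u' ->
    has_gf (fun w => if w is b :: v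
              then (b == i) && ((i <= p' + m)%N && insertion i i u' c v) else false)
      (fun v => q ^+ minv v)
      ((i <= p' + m)%N%:R * (q ^+ count (near i) u'
         * (q ^+ minv u' * qbinom q (c + count (near i) u') c))).
  move=> pu' ui'; case: (i <= p' + m)%N; last first.
    rewrite mul0r; apply: has_gf_ext (has_gf0 _) _ _ => // -[|b v] //=.
    by rewrite andbF.
  rewrite mul1r; apply: has_gf_cons.
  apply: (has_gf_scale (f := fun v => q ^+ minv v)); last first.
    have := IHc u' i (path_all_lt ui' pu') ui'.
    by rewrite leq_addr addnA addn1.
  move=> v /= /and3P[_ /eqP <- _].
  by rewrite count_near_filter exprD.
elim: u p pu ui => [|a u IHu] p pu ui.
  apply: has_gf_ext (gfi p [::] pu ui) _ _ => [[|b v]|] //=.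
    case: (eqVneq b i) => [->|bi] /=; first by rewrite insertion_cons_max.
    by rewrite insertion_cons // andbF.
  rewrite !mul1r addn0 qbinomnn // add0n.
  by case: (i <= p + m)%N;
    rewrite ?addn1 ?addn0 /= ?qbinomnn ?mul1r // mul0r qbinom_small.
have [pa ua] : (a <= p + m)%N /\ path small_rise a u by apply/andP.
have [ai uai] : (a < i)%N /\ all (ltn^~ i) u by apply/andP.
have gfa := IHu a ua uai.
(* Words that begin with the first letter [a] of the old word. As [a < i], the slot behind [a] is
   open exactly when [near i a], so the open slots are the near letters of [a :: u]. *)
have {}gfa : has_gf (fun w => if w is b :: v
                       then (b == a) && insertion i a u c.+1 v else false)
    (fun v => q ^+ minv v)
    (q ^+ count (near a) u
     * (q ^+ minv u * qbinom q (c + count (near i) (a :: u)) c.+1)).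
  apply: has_gf_cons; apply: (has_gf_scale (f := fun v => q ^+ minv v)); last first.
    move: gfa; rewrite addSn /=.
    by rewrite [(near i a + _)%N]addnC /near ai.
  move=> v iv; rewrite exprD; congr (q ^+ _ * _).
  by apply: insertion_minv iv _; rewrite ?(ltnW ai) // neq_ltn ai.
have dis w :
  ~~ ((if w is b :: v
       then (b == i) && ((i <= p + m)%N && insertion i i (a :: u) c v) else false)
   && (if w is b :: v then (b == a) && insertion i a u c.+1 v else false)).
  by case: w => //= b v; case: (eqVneq b i) => //= ->; rewrite (gtn_eqF ai) andbF.
apply: has_gf_ext (has_gfU dis (gfi p (a :: u) pu ui) gfa) _ _ => [[|b v]|] //=.
  case: (eqVneq b i) => [->|bi]; first by rewrite insertion_cons_max (gtn_eqF ai) orbF.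
  by rewrite insertion_cons //; case: eqVneq => [->|]; rewrite ?andbF //= pa.
(* If the front slot is closed, only the second family remains; if it is open, the two families add
   up by the q-Pascal rule. *)
set x := (near i a + count (near i) u)%N; rewrite exprD.
case: (i <= p + m)%N => /=; last by rewrite addn0; ring.
rewrite addn1 addnS.
by rewrite qbinomS ?leq_addr // addKn; ring.
Qed.
End InsertMax.
End Words.

(** * Words of prescribed content *)

Section WordsOfContent.
Variables (m : nat).

(** The letter after a deleted [i] is at most [i], hence still within reach of the letter before. *)
Lemma path_filter_max i p v : all (leq^~ i) v ->
  path (small_rise m) p v -> path (small_rise m) p (filter (predC1 i) v).
Proof.
elim: v p => //= a v IH p /andP[ai vi] /andP[pa av].
case: (eqVneq a i) => [ea|_] /=; last by rewrite pa IH.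
move: (IH a vi av) => {IH}; rewrite ea in pa *.
have: all (leq^~ i) (filter (predC1 i) v).
  by rewrite all_filter; apply: sub_all vi => x /= ->; apply: implybT.
case: (filter _ v) => //= b u /andP[bi _] /andP[_ ->]; rewrite andbT.
exact: leq_trans bi pa.
Qed.

Lemma count_mem_filter (P : pred nat) x s :
  count_mem x (filter P s) = (P x * count_mem x s)%N.
Proof.
elim: s => [|y s IH] /=; first by rewrite muln0.
case: ifP => /= Py; rewrite IH ?mulnDr; case: eqVneq => [<-|]; rewrite ?muln0 //=.
  by rewrite Py mul1n.
by rewrite Py.
Qed.

Lemma eq_count_memP (s t : seq nat) :
  reflect (forall x, count_mem x s = count_mem x t) (perm_eq s t).
Proof.
apply: (iffP idP) => [/permP st x | st]; first exact: st.
by apply/allP => x _; apply/eqP; apply: st.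
Qed.

Lemma perm_filter_leS (s v : seq nat) h :
  perm_eq (0%N :: v) (filter (leq^~ h.+1) s)
  = perm_eq (0%N :: filter (predC1 h.+1) v) (filter (leq^~ h) s)
    && (count_mem h.+1 v == count_mem h.+1 s).
Proof.
apply/eq_count_memP/andP => [e | [/eq_count_memP e /eqP c] x].
  split; last by have := e h.+1; rewrite count_mem_filter leqnn mul1n => <-.
  apply/eq_count_memP => x; have := e x; rewrite /= !count_mem_filter /=.
  have [->|xh] := eqVneq x h.+1; first by rewrite ltnn.
  by rewrite mul1n => ->; rewrite leq_eqVlt (negPf xh) ltnS.
have := e x; rewrite /= !count_mem_filter /=.
have [->|xh] := eqVneq x h.+1; first by rewrite leqnn mul1n c.
by rewrite mul1n => ->; rewrite [in RHS]leq_eqVlt (negPf xh) ltnS.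
Qed.

(** The leading [0] is kept outside [w], as the predecessor of its first letter; the cut at [h]
    prepares the induction on the largest letter. *)
Definition words (s : seq nat) (h : nat) : pred (seq nat) :=
  fun w => path (small_rise m) 0%N w && perm_eq (0%N :: w) (filter (leq^~ h) s).

Variables (K : fieldType) (q : K).
Hypothesis q_neq0 : forall n, \sum_(0 <= j < n.+1) q ^+ j != 0.

(** Deleting the letter [h + 1] maps the words for [h + 1] to those for [h], and by [insertion_gf]
    the weight of a fibre, relative to its base point, depends on the content only. *)
Lemma words_gf s h : 0%N \in s ->
  has_gf (words s h) (fun w => q ^+ minv m w)
    (\prod_(1 <= i < h.+1)
       qbinom q (count (fun b => b <= i <= b + m)%N s).-1 (count_mem i s)).
Proof.
move=> s0; elim: h => [|h IH].
  (* Only the word of zeros remains: it is one letter shorter than the number of zeros of [s] and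
     has no inversion. *)
  rewrite big_geq //.
  have e0 : perm_eq (filter (leq^~ 0%N) s) (nseq (count_mem 0%N s) 0%N).
    apply/eq_count_memP => x; rewrite count_mem_filter leqn0.
    have -> : count_mem x (nseq (count_mem 0%N s) 0%N) = ((x == 0%N) * count_mem 0%N s)%N.
      by rewrite count_nseq /= eq_sym.
    by case: eqVneq => [->|].
  have [c ec] : exists c, count_mem 0%N s = c.+1.
    by exists (count_mem 0%N s).-1; rewrite prednK // -has_count has_pred1.
  have i0 : minv m (nseq c 0%N) = 0%N.
    by elim: c {ec} => //= c ->; rewrite addn0; elim: c.
  apply: has_gf_ext (has_gf1 (fun w => q ^+ minv m w) (nseq c 0%N)) _ _;
    last by rewrite i0.
  move=> w; rewrite /words (permPr e0) ec /=; apply/eqP/andP => [->|[_]].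
    split=> //; by elim: c {ec i0}.
  rewrite perm_cons => pw; rewrite -[c](size_nseq c 0%N) -(perm_size pw).
  by apply/all_pred1P/allP => x; rewrite (perm_mem pw) mem_nseq => /andP[].
set i := h.+1; set c := count_mem i s.
pose y := qbinom q (count (fun b => b <= i <= b + m)%N s).-1 c.
have Qh u v : insertion m i 0 u c v -> filter (predC1 i) v = u by case/and3P => _ /eqP.
rewrite big_nat_recr //= -/i -/c -/y.
apply: has_gf_ext (has_gf_bind (Q := fun u => insertion m i 0 u c) Qh _ IH) _ _ => //.
  move=> u /andP[pu eu].
  have ui : all (ltn^~ i) u.
    apply/allP => x xu; have : x \in 0%N :: u by rewrite inE xu orbT.
    by rewrite (perm_mem eu) mem_filter => /andP[].
  apply: has_gf_ext (insertion_gf q_neq0 c pu ui) _ _ => //.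
  congr (_ * qbinom q _.-1 _).
  (* Since [i > 0], the slot behind the leading [0] is open exactly when [0] is near [i]. So slots
     and copies together count the letters of [s] in [[i - m, i]]. *)
  have -> : (count (near m i) u + (i <= 0 + m))%N = count (near m i) (0%N :: u).
    by rewrite addnC.
  rewrite (permP eu) count_filter /c; elim: s {s0 IH c y Qh eu} => //= x s.
  by rewrite /near /i; lia.
move=> v; rewrite /words /insertion perm_filter_leS eqxx /=.
apply/andP/andP => [[/andP[_ ->] /andP[-> ->]] // | [pv /andP[e c']]].
rewrite pv c' e path_filter_max //.
apply/allP => x xv; case: (eqVneq x i) => [->|xi]; first exact: leqnn.
have : x \in 0%N :: filter (predC1 i) v by rewrite inE mem_filter /= xi xv orbT.
by rewrite (perm_mem e) mem_filter => /andP[/leqW].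
Qed.
End WordsOfContent.

(** * The statistic dinv *)

Fixpoint pair_sum (T : Type) (D : T -> T -> nat) (s : seq T) : nat :=
  if s is x :: s' then (\sum_(y <- s') D x y + pair_sum D s')%N else 0%N.

Lemma eq_pair_sum (T : Type) (D E : T -> T -> nat) s :
  (forall x y, D x y = E x y) -> pair_sum D s = pair_sum E s.
Proof.
by move=> DE; elim: s => //= x s ->; congr (_ + _)%N; apply: eq_bigr.
Qed.

Lemma pair_sumD (T : Type) (D E : T -> T -> nat) s :
  pair_sum (fun x y => D x y + E x y)%N s = (pair_sum D s + pair_sum E s)%N.
Proof. by elim: s => //= x s ->; rewrite big_split /= addnACA. Qed.

Lemma pair_sum_map (S T : Type) (f : S -> T) (D : T -> T -> nat) s :
  pair_sum D (map f s) = pair_sum (fun x y => D (f x) (f y)) s.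
Proof. by elim: s => //= x s ->; rewrite big_map. Qed.

Lemma pair_sum_sum (T : Type) (n : nat) (D : nat -> T -> T -> nat) s :
  (\sum_(0 <= k < n) pair_sum (D k) s)%N
  = pair_sum (fun x y => \sum_(0 <= k < n) D k x y)%N s.
Proof.
elim: n => [|n IH].
  rewrite big_geq //; elim: s => //= x s <-; rewrite addn0 big1 // => y _.
  by rewrite big_geq.
rewrite big_nat_recr //= IH -pair_sumD; apply: eq_pair_sum => x y.
by rewrite big_nat_recr.
Qed.

Lemma card_pairs (T : Type) (x0 : T) (P : T -> T -> bool) (a : seq T) :
  #|[set p : 'I_(size a) * 'I_(size a)
      | (p.1 < p.2)%N && P (nth x0 a p.1) (nth x0 a p.2)]|
  = pair_sum (fun x y => P x y : nat) a.
Proof.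
transitivity (\sum_(i < size a) \sum_(j < size a)
    ((i < j)%N && P (nth x0 a i) (nth x0 a j)))%N.
  rewrite pair_big /= -sum1_card big_mkcond /=; apply: eq_bigr => p _.
  by rewrite inE; case: (_ && _).
elim: a => [|x a IH] /=; first by rewrite big_ord0.
rewrite big_ord_recl; congr (_ + _)%N.
  rewrite big_ord_recl /= add0n (big_nth x0) big_mkord.
  by apply: eq_bigr => j _.
by rewrite -IH; apply: eq_bigr => i _; rewrite big_ord_recl.
Qed.

Lemma sum_leq_const n t : (\sum_(0 <= k < n) (t <= k))%N = (n - t)%N.
Proof. by elim: n => [|n IH]; [rewrite big_geq | rewrite big_nat_recr //= IH; lia]. Qed.

Lemma sum_gtn_const n t : (\sum_(0 <= k < n) (k < t))%N = minn n t.
Proof.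
by elim: n => [|n IH]; [rewrite big_geq ?min0n | rewrite big_nat_recr //= IH; lia].
Qed.

Section Dinv.
Variable m : nat.

(** With truncated subtraction, [(x - y) + (y - x)] is [|x - y|], and the value is
    [max(0, m - |x - y|)]. *)
Definition closeness (x y : nat) : nat := (m - ((x - y) + (y - x)))%N.

(** If [x <= y], the upper bound is automatic and the condition is [k >= y - x]. If [x > y], it is
    [k <= m - (x - y)], which allows one value more than [m - (x - y)] as long as [x - y <= m]; this
    is the inversion. *)
Lemma dinv_pair (x y : nat) :
  (\sum_(0 <= k < m) ((0 <= x%:Z - y%:Z + k%:R <= m%:R)%R : bool))%N
  = (closeness x y + near m x y)%N.
Proof.
rewrite /closeness /near; have [xy|yx] := leqP x y.
  rewrite (eq_big_nat _ _ (F2 := fun k => (y - x <= k)%N : nat)) => [|k km].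
    by rewrite sum_leq_const; lia.
  by congr nat_of_bool; rewrite !natz; lia.
rewrite (eq_big_nat _ _ (F2 := fun k => (k < m.+1 - (x - y))%N : nat)) => [|k km].
  by rewrite sum_gtn_const; lia.
by congr nat_of_bool; rewrite !natz; lia.
Qed.

Lemma minv_pair_sum w : minv m w = pair_sum (fun x y => near m x y : nat) w.
Proof. by elim: w => //= x w ->; rewrite -sumn_count sumnE big_map. Qed.

Lemma dinv_closeness (w : seq nat) :
  dinv m (map Posz w) = (pair_sum closeness w + minv m w)%N.
Proof.
rewrite /dinv; under eq_bigr => k _.
  rewrite (@card_pairs _ 0 (fun x y : int => 0 <= x - y + k%:R <= m%:R)); over.
rewrite pair_sum_sum pair_sum_map minv_pair_sum -pair_sumD.
by apply: eq_pair_sum => x y; apply: dinv_pair.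
Qed.

Lemma mult_cons (a : nat) (s : seq nat) (i : int) :
  mult (map Posz (a :: s)) i = ((a%:Z == i) + mult (map Posz s) i)%N.
Proof. by []. Qed.

Lemma mult_nat (s : seq nat) (i : nat) : mult (map Posz s) i%:Z = count_mem i s.
Proof. by rewrite /mult count_map; apply: eq_count => x. Qed.

(** The one-sided part of [closeness], seen from the larger letter: in a sum over ordered pairs,
    each pair of distinct letters counts once. *)
Definition drop_weight (x y : nat) : nat := if (y < x)%N then (m - (x - y))%N else 0%N.

Lemma drop_weightxx x : drop_weight x x = 0%N.
Proof. by rewrite /drop_weight ltnn. Qed.

(** A letter [y] is met only at [j = i - y]. *)
Lemma sum_mult_below (s : seq nat) (i : nat) :
  (\sum_(1 <= j < m.+1) (m - j) * mult (map Posz s) (i%:Z - j%:Z)%R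
   = \sum_(y <- s) drop_weight i y)%N.
Proof.
elim: s => [|y s IH]; first by rewrite big_nil big1 // => j _; rewrite /mult muln0.
rewrite big_cons -IH; under eq_bigr => j _ do rewrite mult_cons mulnDr.
rewrite big_split /=; congr (_ + _)%N; rewrite /drop_weight.
transitivity (\sum_(1 <= j < m.+1 | j == i - y) if y < i then m - j else 0)%N.
  rewrite [RHS]big_mkcond; apply: eq_big_nat => j j1.
  case: (eqVneq j (i - y)%N) => jE; case: (ltnP y i) => yi; nia.
rewrite big_nat1_eq; case: ifP => //; case: ifP => //; lia.
Qed.

Lemma sum_mult_window (s : seq nat) (i : nat) :
  (\sum_(0 <= j < m.+1) mult (map Posz s) (i%:Z - j%:Z)%R
   = count (fun b => b <= i <= b + m) s)%N.
Proof.
elim: s => [|y s IH]; first by rewrite big1.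
under eq_bigr => j _ do rewrite mult_cons.
rewrite big_split /= IH; congr (_ + _)%N.
transitivity (\sum_(0 <= j < m.+1 | j == i - y) (y <= i : nat))%N.
  rewrite [RHS]big_mkcond; apply: eq_big_nat => j j1.
  case: (eqVneq j (i - y)%N) => jE; case: (leqP y i) => yi; lia.
rewrite big_nat1_eq; case: ifP; lia.
Qed.

Lemma sum_count_mem (s : seq nat) (M : nat) (G : nat -> nat) :
  all (leq^~ M) s -> G 0%N = 0%N ->
  (\sum_(1 <= i < M.+1) count_mem i s * G i = \sum_(x <- s) G x)%N.
Proof.
move=> sM G0; elim: s sM => [|x s IH] /=; first by rewrite big_nil big1.
case/andP=> xM /IH {}IH; rewrite big_cons -IH.
under eq_bigr => j _ do rewrite mulnDl.
rewrite big_split /=; congr (_ + _)%N.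
transitivity (\sum_(1 <= j < M.+1 | j == x) G j)%N.
  rewrite [RHS]big_mkcond; apply: eq_bigr => j _.
  by rewrite eq_sym; case: eqP; rewrite ?mul1n.
by rewrite big_nat1_eq ltnS xM andbT; case: x {xM}.
Qed.

Lemma sum_bin2_cons (s : seq nat) (M a : nat) : (a <= M)%N ->
  (\sum_(0 <= i < M.+1) 'C(count_mem i (a :: s), 2)
   = count_mem a s + \sum_(0 <= i < M.+1) 'C(count_mem i s, 2))%N.
Proof.
move=> aM.
transitivity (\sum_(0 <= i < M.+1)
    ((if i == a then count_mem i s else 0) + 'C(count_mem i s, 2)))%N.
  apply: eq_bigr => i _ /=; rewrite eq_sym; case: eqP => //.
  by rewrite add1n binS bin1 addnC.
by rewrite big_split /= -big_mkcond big_nat1_eq ltnS aM.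
Qed.

(** Each of the ['C(n_i, 2)] pairs of letters equal to [i] contributes [m]; letters [x > y]
    contribute [m - (x - y)] when this is positive. Adding a letter adds its pairs with all others
    to both sides. *)
Lemma cexp_closeness (s : seq nat) (M : nat) : all (leq^~ M) s ->
  cexp m M (mult (map Posz s)) = pair_sum closeness s.
Proof.
move=> sM; rewrite /cexp.
under [X in (_ + X)%N]eq_bigr => i _ do rewrite mult_nat sum_mult_below.
rewrite (sum_count_mem (G := fun i => \sum_(y <- s) drop_weight i y)%N) //; last first.
  by rewrite big1.
under eq_bigr => i _ do rewrite mult_nat.
elim: s sM => [|a s IH].
  by rewrite big_nil addn0 big1 ?muln0.
case/andP=> aM sM; rewrite sum_bin2_cons // big_cons [in LHS]big_cons.
under [X in (_ + (_ + X))%N]eq_bigr => x _ do rewrite big_cons.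
rewrite big_split /= -IH // drop_weightxx add0n mulnDr.
have -> : (\sum_(y <- s) closeness a y
   = m * count_mem a s + \sum_(y <- s) drop_weight a y + \sum_(x <- s) drop_weight x a)%N.
  rewrite -sumn_count sumnE big_map big_distrr -!big_split; apply: eq_bigr => y _ /=.
  rewrite /closeness /drop_weight; case: (ltngtP a y); lia.
by ring.
Qed.

Lemma qprod_window (K : fieldType) (q : K) (s : seq nat) M :
  qprod q m M (mult (map Posz s))
  = \prod_(1 <= i < M.+1)
       qbinom q (count (fun b => b <= i <= b + m)%N s).-1 (count_mem i s).
Proof. by apply: eq_bigr => i _; rewrite sum_mult_window mult_nat. Qed.

End Dinv.

(** * Boards and words *)

Section Boards.
Variable m : nat.

(** This inverts [omega]; by [path_small_rise_nth] the subtraction is exact on words that start with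
    [0] and have small rises. *)
Definition columns (s : seq nat) : seq nat :=
  [seq (j * m - nth 0 s j)%N | j <- iota 0 (size s)].

Definition board (s : seq nat) : seq nat := filter (predC1 0%N) (columns s).

Lemma nth_columns s j : (j < size s)%N -> nth 0%N (columns s) j = (j * m - nth 0 s j)%N.
Proof. by move=> js; rewrite (nth_map 0%N) ?size_iota // nth_iota. Qed.

(** In a weakly increasing sequence the zeros come first, so padding restores what the filter
    removes. *)
Lemma pad_filter (h : seq nat) : sorted leq h ->
  pad (size h) (filter (predC1 0%N) h) = h.
Proof.
rewrite /pad; elim: h => //= x h IH hx; have sh := path_sorted hx.
have [x0|x0] := eqVneq x 0%N => /=.
  by rewrite subSn ?size_filter ?count_size //= -size_filter IH // x0.
have /all_filterP -> : all (predC1 0%N) h.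
  apply/allP => y yh /=; rewrite -lt0n.
  by apply: leq_trans (allP (order_path_min leq_trans hx) y yh); rewrite lt0n.
by rewrite subnn.
Qed.

Lemma filter_pad N B : is_ferrers B -> filter (predC1 0%N) (pad N B) = B.
Proof.
case/andP=> _ B0; rewrite /pad filter_cat.
have -> : filter (predC1 0%N) (nseq (N - size B) 0%N) = [::].
  by elim: (N - size B)%N.
by apply/all_filterP/allP => x xB; apply: contraNneq B0 => <-.
Qed.

Lemma sorted_pad N B : sorted leq B -> sorted leq (pad N B).
Proof.
rewrite /pad; elim: (N - size B)%N => //= n IH /IH.
by case: (_ ++ _).
Qed.

Lemma path_small_rise_nth p w j :
  path (small_rise m) p w -> (j <= size w)%N -> (nth 0 (p :: w) j <= p + j * m)%N.
Proof.
elim: j p w => [|j IH] p [|a w] //=; rewrite ?leq_addr //.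
case/andP=> pa aw jw; apply: leq_trans (IH a w aw jw) _.
by move: pa; rewrite /small_rise mulSn; lia.
Qed.

Lemma sorted_columns w : path (small_rise m) 0%N w -> sorted leq (columns (0%N :: w)).
Proof.
move=> pw; apply/(sortedP 0%N) => j; rewrite size_map size_iota => jw.
rewrite !nth_columns //; last exact: ltnW.
have := pathP 0%N pw; move=> /(_ j); rewrite /small_rise mulSn => /(_ jw) /=.
lia.
Qed.

Lemma board_ferrers w : path (small_rise m) 0%N w -> is_ferrers (board (0%N :: w)).
Proof.
move=> /sorted_columns sw; rewrite /is_ferrers (sorted_filter leq_trans) //=.
by rewrite mem_filter.
Qed.

Lemma size_board s : (size (board s) <= size s)%N.
Proof. by rewrite size_filter (leq_trans (count_size _ _)) // size_map size_iota. Qed.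

Lemma omega_board w : path (small_rise m) 0%N w ->
  omega m (size w).+1 (board (0%N :: w)) = map Posz (0%N :: w).
Proof.
move=> pw; apply: (@eq_from_nth _ 0); first by rewrite size_omega size_map.
move=> j; rewrite size_omega => jw; rewrite nth_omega //.
have <- : size (columns (0%N :: w)) = (size w).+1 by rewrite size_map size_iota.
rewrite pad_filter ?sorted_columns // nth_columns // (nth_map 0%N) //.
have := path_small_rise_nth pw (j := j); rewrite -ltnS => /(_ jw); lia.
Qed.

(* The first column of the padded board has height [0], because entry [0] of   *)
(* [omega] is nonnegative.                                                     *)
Lemma board_of_omega N B s : is_ferrers B -> (size B <= N.+1)%N ->
  omega m N.+1 B = map Posz s ->
  exists w, [/\ s = 0%N :: w, path (small_rise m) 0%N w & B = board s].
Proof.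
move=> fB BN e.
have ss : size s = N.+1 by rewrite -(size_map Posz) -e size_omega.
have en j : (j < N.+1)%N -> (j * m)%N%:Z - (nth 0%N (pad N.+1 B) j)%:Z = (nth 0%N s j)%:Z.
  by move=> jN; rewrite -nth_omega // e (nth_map 0%N) ?ss.
have eB : B = board s.
  rewrite -[LHS](filter_pad N.+1 fB) /board; congr filter.
  apply: (@eq_from_nth _ 0%N); first by rewrite size_pad // size_map size_iota ss.
  move=> j; rewrite size_pad // => jN; rewrite nth_columns ?ss //.
  have := en j jN; lia.
case: s => [|a w] // in e ss en eB *; exists w.
have a0 : a = 0%N by have := en 0%N isT; rewrite /=; lia.
rewrite a0 in e ss en eB *; split=> //.
apply/(pathP 0%N) => j jw; rewrite /small_rise.
have jN : (j.+1 < N.+1)%N by rewrite -ss.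
have := en j (ltnW jN); have := en j.+1 jN.
have /(sortedP 0%N) := sorted_pad N.+1 (proj1 (andP fB)).
move=> /(_ j); rewrite size_pad // => /(_ jN); rewrite /= mulSn; lia.
Qed.

Lemma fits_size N B : fits m N B -> (size B <= N)%N.
Proof. by case/andP. Qed.

(** More padding moves columns to the right, where greater heights are allowed. This serves the
    comparison with boards not yet known to have at most [N] columns. *)
Lemma fits_pad n N B : fits m N B -> (N <= n)%N ->
  forall j, (j < n)%N -> (nth 0 (pad n B) j <= j * m)%N.
Proof.
case/andP=> BN /forallP fB Nn j jn; rewrite /pad nth_cat size_nseq nth_nseq.
case: ltnP => nj; first exact: leq0n.
set k := (j - (n - size B))%N.
have kN : (N - size B + k < N)%N by lia.
have := fB (Ordinal kN); rewrite /= /pad nth_cat size_nseq ltnNge leq_addr /= addKn.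
by move/leq_trans; apply; rewrite leq_mul2r; apply/orP; right; lia.
Qed.

Lemma omega_ge0 n N B : fits m N B -> (N <= n)%N -> all (fun x => 0 <= x) (omega m n B).
Proof.
move=> fB Nn; apply/(all_nthP 0) => j; rewrite size_omega => jn.
by rewrite nth_omega //; have := fits_pad fB Nn jn; lia.
Qed.

Lemma omega_natE n N B : fits m N B -> (N <= n)%N ->
  omega m n B = map Posz (map absz (omega m n B)).
Proof.
move=> fB Nn; rewrite -map_comp -[LHS]map_id; apply/eq_in_map => x xo /=.
by have := allP (omega_ge0 fB Nn) x xo; case: x xo.
Qed.

(* Otherwise the first column of [B], of positive height, would give a        *)
(* negative entry of [omega].                                                  *)
Lemma weight_file_equiv_size N B B0 :
  is_ferrers B -> sorted leq B0 -> fits m N B0 -> weight_file_equiv m B B0 ->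
  (size B <= N)%N.
Proof.
move=> /andP[sB B_0] sB0 fB0 e; rewrite leqNgt; apply/negP => NB.
have B0B := leq_trans (fits_size fB0) (ltnW NB).
move/(weight_file_equiv_omega m sB sB0 (leqnn _) B0B): e => e.
have: nth 0 (omega m (size B) B) 0 \in omega m (size B) B0.
  by rewrite -(perm_mem e) mem_nth // size_omega (leq_ltn_trans _ NB).
move/(allP (omega_ge0 fB0 (ltnW NB))); rewrite nth_omega ?(leq_ltn_trans _ NB) //.
rewrite /pad subnn; have : nth 0%N B 0 \in B by rewrite mem_nth // (leq_ltn_trans _ NB).
case: (nth 0%N B 0) (B_0) => [/negPf->|] //=; lia.
Qed.

End Boards.

Lemma eq_cexp m M (n n' : int -> nat) : n =1 n' -> cexp m M n = cexp m M n'.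
Proof.
move=> nn; rewrite /cexp; congr (_ * _ + _)%N; apply: eq_bigr => i _; rewrite nn //.
by congr (_ * _)%N; apply: eq_bigr => j _; rewrite nn.
Qed.

(** The sum is a polynomial with constant coefficient [1]. *)
Lemma qvar_sum_neq0 n : \sum_(0 <= j < n.+1) qvar ^+ j != 0.
Proof.
rewrite (eq_bigr (fun j => tofrac ('X^j : {poly rat})));
  last by move=> j _; rewrite rmorphXn.
rewrite -rmorph_sum tofrac_eq0; apply/eqP => /(congr1 (fun p : {poly rat} => p`_0)).
rewrite coef0 coef_sum big_nat_recl //= coefXn eqxx big1 => [|j _];
  last by rewrite coefXn.
by apply/eqP; rewrite addr0 oner_eq0.
Qed.

(* The sum over all boards equivalent to B0 is the sum over a duplicate-free
   enumeration S of them; its existence says that there are finitely many. *)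
Theorem theorem8p5 (m N : nat) (B0 : seq nat) :
  (0 < m)%N -> is_ferrers B0 -> fits m N B0 ->
  exists S : seq (seq nat),
    [/\ uniq S,
        (forall B : seq nat,
           B \in S <-> (is_ferrers B /\ weight_file_equiv m B B0)) &
        \sum_(B <- S) qvar ^+ dinv_board m N B
        = qvar ^+ cexp m (N * m) (mult (omega m N B0))
          * qprod qvar m (N * m) (mult (omega m N B0))].
Proof.
move=> _ fB0 fit; have sB0 := proj1 (andP fB0); have BN := fits_size fit.
(* Words have a leading [0], hence at least one column; for [N = 0] the empty board is alone in its
   class. *)
case: N => [|N] in fit BN *.
  have -> : B0 = [::] by apply: size0nil; apply/eqP; rewrite -leqn0.
  exists [:: [::]]; split=> // [B|].
    rewrite inE; split=> [/eqP->|[fB e]]; first by split.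
    rewrite -size_eq0 -leqn0; apply: weight_file_equiv_size fB _ _ e => //.
    by rewrite /fits; apply/andP; split=> //; apply/forallP => -[].
  have d0 : dinv_board m 0 [::] = 0%N by apply: (dinv_closeness m [::]).
  have c0 : cexp m (0 * m) (mult (omega m 0 [::])) = 0%N.
    exact: (@cexp_closeness m [::] (0 * m)).
  by rewrite big_seq1 d0 c0 /qprod big_geq // mulr1.
set s := map absz (omega m N.+1 B0); have es := omega_natE fit (leqnn _).
rewrite -/s in es.
have [w0 [sE pw0 _]] := board_of_omega fB0 BN es.
have s0 : 0%N \in s by rewrite sE inE.
have sM : all (leq^~ (N.+1 * m)%N) s.
  apply/(all_nthP 0%N) => j; rewrite sE => js.
  apply: leq_trans (path_small_rise_nth pw0 js) _; rewrite add0n leq_mul2r.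
  by apply/orP; right; move: js; rewrite -sE size_map size_omega => /ltnW.
(* All letters are below the bound, so the cut in [words] is void and every rearrangement of [s]
   with leading [0] and small rises is counted. *)
have sfull : filter (leq^~ (N.+1 * m)%N) s = s by apply/all_filterP.
have [L [uL LP sumL]] := words_gf m qvar_sum_neq0 (N.+1 * m) s0.
have omL w : w \in L -> [/\ path (small_rise m) 0%N w, perm_eq (0%N :: w) s
    & omega m N.+1 (board m (0%N :: w)) = map Posz (0%N :: w)].
  rewrite LP /words sfull => /andP[pw ew]; split=> //.
  have <- : size w = N; last exact: omega_board.
  by have := perm_size ew; rewrite size_map size_omega => -[].
exists [seq board m (0%N :: w) | w <- L]; split.
(* [omega] recovers the word from its board. *)
- rewrite map_inj_in_uniq // => w w' /omL[_ _ ew] /omL[_ _ ew'] e.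
  by move: ew; rewrite e ew' => /= -[/(inj_map (can_inj absz_nat))].
- move=> B; split=> [/mapP[w wL ->]|[fB e]].
    have [pw ew ow] := omL w wL; split; first exact: board_ferrers.
    have fw := board_ferrers pw.
    have sw : (size (board m (0%N :: w)) <= N.+1)%N.
      apply: leq_trans (size_board _ _) _.
      by rewrite (perm_size ew) size_map size_omega.
    apply/(weight_file_equiv_omega m (proj1 (andP fw)) sB0 sw BN).
    by rewrite ow es; apply: perm_map.
  have sB := weight_file_equiv_size fB sB0 fit e.
  move/(weight_file_equiv_omega m (proj1 (andP fB)) sB0 sB BN): e => e.
  have [t et] : exists t, omega m N.+1 B = map Posz t.
    exists (map absz (omega m N.+1 B)); rewrite -map_comp -[LHS]map_id.
    apply/eq_in_map => x; rewrite (perm_mem e) => /(allP (omega_ge0 fit (leqnn _))).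
    by case: x.
  have [w [tE pw ->]] := board_of_omega fB sB et.
  rewrite tE; apply: (map_f (fun w => board m (0%N :: w))).
  rewrite LP /words sfull pw /= -tE; apply: (perm_map_inj (f := Posz)).
    exact: can_inj absz_nat.
  by rewrite -et -es.
rewrite big_map es qprod_window -sumL big_distrr; apply: eq_big_seq => w /omL[pw ew ow].
rewrite /dinv_board ow dinv_closeness exprD; congr (qvar ^+ _ * qvar ^+ _).
  rewrite -(@cexp_closeness m _ (N.+1 * m)) ?(perm_all _ ew) //.
  by apply: eq_cexp => i; apply/permP/perm_map.
(* No letter is smaller than the leading [0], so it starts no inversion. *)
by rewrite /= (eq_count (a2 := pred0)) ?count_pred0.
Qed.
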